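(* Let $U_h, V_h \subset U$ be finite-dimensional subspaces satisfying the discrete inf-sup condition $$\inf_{w_h \in U_h\setminus\{0\}} \ \sup_{v_h \in V_h\setminus\{0\}} \frac{a(w_h,v_h)}{\|w_h\|_U\|v_h\|_U} \geq \beta, \qquad \beta>0.$$ For $w_h \in U_h$ let $r_h(w_h)\in V_h$ be the discrete Riesz representative of the residual, i.e. $(r_h(w_h),v_h)_U = \bar\ell(v_h) - a(w_h,v_h)$ for all $v_h\in V_h$. Then the discrete quadratic minimisation problem $$u_h = \underset{w_h \in U_h}{\mathrm{arg\,min}}\ \|r_h(w_h)\|_U$$ is well-posed. It can be restated as: find $u_h\in U_h$ and $r_h = r_h(u_h)\in V_h$ such that $$(r_h,v_h)_U + a(u_h,v_h) = \bar\ell(v_h)\quad \forall v_h\in V_h, \qquad a(w_h,r_h) = 0 \quad \forall w_h\in U_h.$$ Moreover, the solution satisfies the a priori estimates $$\|r_h\|_U \leq \inf_{w_h\in U_h} 4\gamma\|u-w_h\|_U, \qquad \|u-u_h\|_U \leq \Big(1+\frac{4\gamma}{\beta}\Big)\inf_{w_h\in U_h}\|u-w_h\|_U .$$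
   Context: $U$ is a real Hilbert space with inner product $(\cdot,\cdot)_U$ and induced norm $\|\cdot\|_U$. $a:U\times U\to\mathbb{R}$ is a bilinear form that is continuous with constant $\gamma>0$: $a(w,v)\le\gamma\|w\|_U\|v\|_U$ for all $w,v\in U$, and satisfies the continuous inf-sup condition $\inf_{w\in U}\sup_{v\in U} a(w,v)/(\|w\|_U\|v\|_U)\ge\beta_0>0$. $\bar\ell\in U'$ is a bounded linear functional (it collects the right-hand side and the Dirichlet lifting), and $u\in U$ is the solution of the continuous problem $a(u,v)=\bar\ell(v)$ for all $v\in U$, which is assumed well-posed. The dimensions of $U_h$ and $V_h$ are not assumed equal. ''Well-posed'' means: there is a unique solution, and it depends continuously on the data $\bar\ell$. *)

(* Defs.v *)
From HB Require Import structures.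
From mathcomp Require Import all_boot all_order all_algebra sesquilinear.
From mathcomp Require Import all_classical all_reals all_analysis.

Set Implicit Arguments.
Unset Strict Implicit.
Unset Printing Implicit Defensive.

Import Order.TTheory GRing.Theory Num.Theory numFieldNormedType.Exports.

Local Open Scope classical_set_scope.
Local Open Scope ring_scope.

(* A real Hilbert space is a complete normed module U together with an inner
   product that induces its norm. *)
Definition induces_norm (R : realType) (U : completeNormedModType R)
    (dot : {dot U for idfun}) : Prop :=
  forall x : U, `|x| = Num.sqrt (dot x x).

Definition finite_dim_subspace (R : realType) (U : lmodType R)
    (V : set U) : Prop :=
  exists (n : nat) (e : 'I_n -> U),
    V = [set \sum_(i < n) c i *: e i | c in [set: 'I_n -> R]].

Section Functionals.
Context (R : realType) (U : completeNormedModType R).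

Definition bounded_functional (l : {scalar U}) : Prop :=
  exists M : R, forall v : U, `|l v| <= M * `|v|.

Definition dual_norm (l : U -> R) : \bar R :=
  ereal_sup [set `|l v|%:E | v in [set v : U | `|v| <= 1]].

(* Well-posedness in the sense of Hadamard, for a problem whose data range over
   the dual space of U: P l x reads "x solves the problem with datum l". *)
Definition well_posed (X : normedModType R)
    (P : {scalar U} -> set X) : Prop :=
  (forall l : {scalar U}, bounded_functional l -> exists! x : X, P l x) /\
  (forall (l : {scalar U}) (x : X), bounded_functional l -> P l x ->
   forall eps : R, 0 < eps -> exists2 delta : R, 0 < delta &
   forall (l' : {scalar U}) (x' : X), bounded_functional l' -> P l' x' ->
     (dual_norm (l' \- l)%R < delta%:E)%E -> `|x' - x| < eps).

End Functionals.

Section Problems.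
Context (R : realType) (U : completeNormedModType R).
Variables (dot : {dot U for idfun}) (a : {biscalar U}).

(* The infimum and the supremum are taken in the extended reals: the infimum
   over an empty set is +oo, the supremum over an empty set is -oo. *)
Definition inf_sup (W V : set U) : \bar R :=
  ereal_inf [set ereal_sup [set (a w v / (`|w| * `|v|))%:E | v in V `\ 0]
            | w in W `\ 0].

Definition continuous_problem (l : {scalar U}) : set U :=
  [set u | forall v : U, a u v = l v].

Variables Uh Vh : set U.

Definition is_residual_riesz (l : {scalar U}) (w r : U) : Prop :=
  Vh r /\ forall v : U, Vh v -> dot r v = l v - a w v.

(* r_h(w), with the junk value 0 if there is no representative. *)
Definition residual_riesz (l : {scalar U}) (w : U) : U :=
  xget 0 [set r | is_residual_riesz l w r].

(* argmin over w in Uh of |r_h(w)| *)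
Definition residual_minimisers (l : {scalar U}) : set U :=
  [set u | Uh u /\
    forall w : U, Uh w -> `|residual_riesz l u| <= `|residual_riesz l w|].

Definition mixed_problem (l : {scalar U}) (u r : U) : Prop :=
  [/\ Uh u, Vh r,
      forall v : U, Vh v -> dot r v + a u v = l v
    & forall w : U, Uh w -> a w r = 0].

End Problems.

(* Main.v *)
Require Import Defs.
From HB Require Import structures.
From mathcomp Require Import all_boot all_order all_algebra sesquilinear.
From mathcomp Require Import all_classical all_reals all_analysis.
From mathcomp Require Import ring lra.

Set Implicit Arguments.
Unset Strict Implicit.
Unset Printing Implicit Defensive.

Import Order.TTheory GRing.Theory Num.Theory numFieldNormedType.Exports.
Local Open Scope classical_set_scope.
Local Open Scope ring_scope.

(** The residual [r w] of [w] in [Uh] depends affinely on [w]: writing [T w] for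
    the element of [Vh] that represents [a w] on [Vh], one has
    [r w = r 0 - T w].  Minimising the norm of [r w] is thus a least-squares
    problem over the finite-dimensional space [T Uh], and its normal equations,
    [dot (T w) (r u) = 0] for all [w] in [Uh], read [a w (r u) = 0] because
    [r u] lies in [Vh].  They are the second line of the mixed problem, the
    first line being the definition of the residual.  So there are three facts
    to establish.

    - Existence ([mixed_problem_exists]): project [r 0] orthogonally on [T Uh].
      The projection, like the residual itself, comes from the Riesz theorem on
      a finite-dimensional subspace ([riesz_on_family]).

    - Normal equations ([residual_minimisersP]): by Pythagoras a solution of the
      mixed problem is a minimiser, and any other minimiser has the same
      residual.

    - Stability ([mixed_problem_stability]): if the datum is bounded by [D] on
      [Vh], testing the mixed problem with [r] bounds [r] by [D], and the
      discrete inf-sup condition then bounds [beta * `|u|] by [2 * D].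

    The mixed problem being linear, stability applied to differences of
    solutions gives uniqueness and continuous dependence on the datum.  Since
    [u] solves the continuous problem, for any [w] in [Uh] the pair [(uh - w, rh)]
    solves the mixed problem whose datum is the functional [a (u - w)], of bound
    [gamma * `|u - w|]; stability then yields both a priori estimates, with
    [gamma] and [2 * gamma] in place of [4 * gamma]. *)

(** * Riesz representation on finite-dimensional subspaces *)

Section FiniteDimension.
Context (R : realType) (U : lmodType R).
Implicit Types (V : set U).

Lemma finite_dim0 V : finite_dim_subspace V -> V 0.
Proof.
move=> [n [e ->]]; exists (fun=> 0) => //.
by rewrite big1// => i _; rewrite scale0r.
Qed.

Lemma finite_dimP V k x y :
  finite_dim_subspace V -> V x -> V y -> V (k *: x + y).
Proof.
move=> [n [e ->]] [c _ <-] [d _ <-]; exists (fun i => k * c i + d i) => //.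
rewrite scaler_sumr -big_split/=; apply: eq_bigr => i _.
by rewrite scalerDl scalerA.
Qed.

Lemma finite_dimB V x y : finite_dim_subspace V -> V x -> V y -> V (x - y).
Proof.
by move=> finV Vx Vy; rewrite addrC -scaleN1r; exact: finite_dimP.
Qed.

Context (dot : {dot U for idfun}).

Lemma dotC x y : dot x y = dot y x.
Proof. by rewrite hermC expr0 mul1r. Qed.

Lemma dot_eq0 x : dot x x = 0 -> x = 0.
Proof.
move=> x0; apply/eqP/negPn/negP => /(neq0_dnorm_gt0 (s := dot)).
by rewrite x0 ltxx.
Qed.

Lemma dot_ge0 x : 0 <= dot x x.
Proof.
have [->|/(neq0_dnorm_gt0 (s := dot))/ltW//] := eqVneq x 0.
by rewrite linear0r.
Qed.

(** Gram-Schmidt: the first vector is split into its orthogonal projection [p]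
    on the span of the others and a remainder [g], and the representative for
    the other vectors is corrected by a multiple of [g].  Linear dependence only
    makes [g], and with it the correction, vanish. *)
Lemma riesz_on_family n (e : 'I_n -> U) (f : {scalar U}) :
  exists c : 'I_n -> R, forall j, dot (\sum_i c i *: e i) (e j) = f (e j).
Proof.
elim: n e f => [|n IHn] e f; first by exists (fun=> 0) => -[].
pose e' i := e (lift ord0 i).
have [q qE] := IHn e' (dot (e ord0)).
have [c cE] := IHn e' f.
set p := \sum_i q i *: e' i in qE; set r := \sum_i c i *: e' i in cE.
pose g := e ord0 - p.
have ge' j : dot g (e' j) = 0 by rewrite linearBl/= qE subrr.
have gp : dot g p = 0.
  by rewrite linear_sum big1// => i _; rewrite linearZ/= ge' mulr0.
have rg : dot r g = 0.
  rewrite dotC linear_sum big1// => i _; rewrite linearZ/=.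
  by rewrite ge' mulr0.
have rp : dot r p = f p.
  by rewrite !linear_sum; apply: eq_bigr => i _; rewrite !linearZ/= cE.
have e0E : e ord0 = g + p by rewrite subrK.
(* When g = 0 both sides vanish, whatever the junk value of the quotient. *)
pose t := f g / dot g g.
have tgg : t * dot g g = f g.
  have [g0|g0] := eqVneq g 0; first by rewrite g0 linear0r linear0 mulr0.
  by rewrite divfK// gt_eqF// neq0_dnorm_gt0.
exists (fun i => oapp (fun j => c j - t * q j) t (unlift ord0 i)) => j.
have -> : \sum_i oapp (fun j => c j - t * q j) t (unlift ord0 i) *: e i
    = r + t *: g.
  rewrite big_ord_recl unlift_none/= scalerBr addrCA; congr (_ + _).
  rewrite scaler_sumr -sumrB; apply: eq_bigr => i _.
  by rewrite liftK/= scalerBl scalerA.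
rewrite linearDl linearZl_LR/=; case: (unliftP ord0 j) => [i|] ->.
  by rewrite -/(e' i) cE ge' mulr0 addr0.
rewrite e0E; clearbody t; clearbody g.
by rewrite !linearD/= rg rp gp add0r addr0 tgg addrC.
Qed.

Lemma riesz_finite_dim V (f : {scalar U}) : finite_dim_subspace V ->
  exists2 r, V r & forall v, V v -> dot r v = f v.
Proof.
move=> [n [e ->]]; have [c cE] := riesz_on_family e f.
exists (\sum_i c i *: e i); first by exists c.
move=> _ [d _ <-]; rewrite !linear_sum; apply: eq_bigr => i _.
by rewrite !linearZ/= cE.
Qed.

Lemma eq_from_dot V x y : finite_dim_subspace V -> V x -> V y ->
  (forall v, V v -> dot x v = dot y v) -> x = y.
Proof.
move=> finV Vx Vy xy; apply/subr0_eq/dot_eq0.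
by rewrite linearBl/= xy ?subrr//; exact: finite_dimB.
Qed.

End FiniteDimension.
Arguments dotC {R U} dot x y.
Arguments riesz_on_family {R U} dot {n} e f.
Arguments riesz_finite_dim {R U} dot {V} f.
Arguments eq_from_dot {R U} dot {V x y}.

(** * Norm, dual norm and inf-sup bounds *)

Section Bounds.
Context (R : realType) (U : completeNormedModType R).

Section InducedNorm.
Context (dot : {dot U for idfun}) (dotN : induces_norm dot).

Lemma sqr_norm_dot x : `|x| ^+ 2 = dot x x.
Proof. by rewrite dotN sqr_sqrtr// dot_ge0. Qed.

(** The norm is already known to satisfy the triangle inequality, whose square
    is the Cauchy-Schwarz inequality. *)
Lemma dot_le_norm x y : dot x y <= `|x| * `|y|.
Proof.
have : `|x + y| ^+ 2 <= (`|x| + `|y|) ^+ 2.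
  by rewrite ler_pXn2r ?nnegrE ?addr_ge0// ler_normD.
rewrite sqrrD !sqr_norm_dot linearDl !linearD/= (dotC dot y x).
lra.
Qed.

End InducedNorm.

Lemma dual_norm_bound (l : {scalar U}) (d : R) :
  (dual_norm l < d%:E)%E -> forall v, l v <= d * `|v|.
Proof.
move=> ld v; have [->|v0] := eqVneq v 0.
  by rewrite linear0 normr0 mulr0.
have nv : 0 < `|v| by rewrite normr_gt0.
rewrite -ler_pdivrMr//.
have : (`|l (`|v|^-1 *: v)|%:E <= d%:E)%E.
  apply/(le_trans _ (ltW ld))/ereal_sup_ubound.
  exists (`|v|^-1 *: v) => //=.
  by rewrite normrZ normfV normr_id mulVf// gt_eqF.
by rewrite lee_fin linearZ/= mulrC; apply: le_trans; rewrite ler_norm.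
Qed.

(** The quotients below the supremum for [w] are all at most [K / `|w|], hence so
    is [b].  This covers a [V] without nonzero vector, where the supremum is
    [-oo] and the inf-sup condition leaves no nonzero [w]. *)
Lemma inf_sup_bound (a : {biscalar U}) (W V : set U) (b K : R) w :
  (b%:E <= inf_sup a W V)%E -> W w -> 0 <= K ->
  (forall v, V v -> a w v <= K * `|v|) -> b * `|w| <= K.
Proof.
move=> bWV Ww K0 aK; have [->|w0] := eqVneq w 0; first by rewrite normr0 mulr0.
have nw : 0 < `|w| by rewrite normr_gt0.
rewrite -ler_pdivlMr// -lee_fin; apply: (le_trans bWV).
apply: (@le_trans _ _
  (ereal_sup [set (a w v / (`|w| * `|v|))%:E | v in V `\ 0])).
  by apply: ereal_inf_lbound; exists w => //; split => //; exact/eqP.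
apply/ereal_supP => _ [v [Vv /eqP v0] <-].
have nv : 0 < `|v| by rewrite normr_gt0.
rewrite lee_fin ler_pdivrMr ?mulr_gt0//.
by rewrite mulrA divfK ?gt_eqF//; exact: aK.
Qed.

End Bounds.

(** * Residual minimisation and the mixed problem *)

Section ResidualMinimisation.
Context (R : realType) (U : completeNormedModType R).
Context (dot : {dot U for idfun}) (a : {biscalar U}) (Uh Vh : set U).
Context (dotN : induces_norm dot).
Context (finU : finite_dim_subspace Uh) (finV : finite_dim_subspace Vh).
Implicit Types (l : {scalar U}) (u w r : U).

Local Notation rr := (residual_riesz dot a Vh).
Local Notation mixed := (mixed_problem dot a Uh Vh).
Local Notation minimisers := (residual_minimisers dot a Uh Vh).

Lemma residual_riesz_exists_unique l w :
  exists! r, is_residual_riesz dot a Vh l w r.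
Proof.
have [r Vr rE] := riesz_finite_dim dot (l \- a w) finV.
exists r; split=> [|s [Vs sE]]; first by split.
by apply: (eq_from_dot dot finV) => // v Vv; rewrite rE// sE.
Qed.

Lemma residual_rieszP l w : is_residual_riesz dot a Vh l w (rr l w).
Proof.
apply: xgetPex.
by have [r [rP _]] := residual_riesz_exists_unique l w; exists r.
Qed.

Lemma mixed_problemP l u r :
  mixed l u r <->
  [/\ Uh u, r = rr l u & forall w, Uh w -> a w r = 0].
Proof.
have [Vrr rrE] := residual_rieszP l u; split=> [[Uu Vr rE ra]|[Uu -> ra]].
  split=> //; apply: (eq_from_dot dot finV) => // v Vv.
  by rewrite rrE// -rE// addrK.
by split=> // v Vv; rewrite rrE// subrK.
Qed.

Lemma mixed_problemB l l' u u' r r' :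
  mixed l u r -> mixed l' u' r' -> mixed (l \- l') (u - u') (r - r').
Proof.
move=> [Uu Vr rE ra] [Uu' Vr' rE' ra']; split; try exact: finite_dimB.
- move=> v Vv; rewrite !linearBl/= -rE// -rE'//; ring.
- by move=> w Uw; rewrite linearB/= ra// ra'// subrr.
Qed.

(** With [t i] the representative on [Vh] of [a (e i)], where [e] spans [Uh],
    the space [T Uh] is spanned by the vectors [t i]; the coordinates on [t] of
    the projection of the residual of [0] are those of the solution on [e]. *)
Lemma mixed_problem_exists l : exists u r, mixed l u r.
Proof.
case: (finU) => n [e UhE].
have /choice[t tP] : forall i, exists r,
    Vh r /\ forall v, Vh v -> dot r v = a (e i) v.
  move=> i.
  by have [r Vr rE] := riesz_finite_dim dot (a (e i)) finV; exists r.
have [r0 Vr0 r0E] := riesz_finite_dim dot l finV.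
have [c cE] := riesz_on_family dot t (dot r0).
set q := \sum_i c i *: t i in cE.
have Vq : Vh q.
  rewrite /q; elim/big_ind: _ => [|x y Vx Vy|i _].
  - exact: finite_dim0.
  - by rewrite -(scale1r x); exact: finite_dimP.
  - rewrite -(addr0 (_ *: _)); apply: finite_dimP => //.
      by case: (tP i).
    exact: finite_dim0.
exists (\sum_i c i *: e i), (r0 - q); split.
- by rewrite UhE; exists c.
- exact: finite_dimB.
- move=> v Vv; rewrite linearBl/= r0E// !linear_sumlz.
  rewrite [X in _ - X + _](_ : _ = \sum_i a (c i *: e i) v) ?subrK//.
  by apply: eq_bigr => i _; rewrite !linearZl_LR/= (tP i).2.
- rewrite UhE => _ [d _ <-]; rewrite linear_sumlz big1// => i _.
  rewrite linearZl_LR/= -(tP i).2; last exact: finite_dimB.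
  by rewrite linearB/= dotC (dotC dot (t i)) cE subrr mulr0.
Qed.

(** The residuals of two elements of [Uh] differ by the representative of some
    [a w] with [w] in [Uh], which is orthogonal to [r]. *)
Lemma residual_pythagoras l u r w : mixed l u r -> Uh w ->
  `|rr l w| ^+ 2 = `|r| ^+ 2 + `|rr l w - r| ^+ 2.
Proof.
move=> [Uu Vr rE ra] Uw; have [Vs sE] := residual_rieszP l w.
rewrite !(sqr_norm_dot dotN).
have dr : dot (rr l w - r) r = 0.
  have -> : dot (rr l w - r) r = a (u - w) r.
    by rewrite !linearBl/= sE// -rE//; ring.
  by apply: ra; exact: finite_dimB.
by rewrite -{1 2}(subrK r (rr l w)) (hnormDd dr) addrC.
Qed.

Lemma residual_minimisersP l u r :
  minimisers l u /\ r = rr l u <-> mixed l u r.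
Proof.
split=> [[[Uu minu] ->]|mix]; last first.
  have /mixed_problemP[Uu rE ra] := mix; split=> //; split=> // w Uw.
  rewrite -rE -(ler_pXn2r (n := 2)) ?nnegrE//.
  by rewrite (residual_pythagoras mix Uw) lerDl sqr_ge0.
have [u0 [r0 mix]] := mixed_problem_exists l.
have /mixed_problemP[Uu0 r0E r0a] := mix.
apply/mixed_problemP; split=> //.
suff -> : rr l u = r0 by [].
have : `|rr l u| ^+ 2 <= `|r0| ^+ 2.
  by rewrite ler_pXn2r ?nnegrE// r0E; exact: minu.
rewrite (residual_pythagoras mix Uu) gerDl => h.
apply/subr0_eq/eqP; rewrite -normr_eq0 -sqrf_eq0.
by rewrite eq_le h sqr_ge0.
Qed.

Context (beta : R) (beta_gt0 : 0 < beta).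
Context (infsup : (beta%:E <= inf_sup a Uh Vh)%E).

(** Testing with [r] kills the term [a u r]; the equation then bounds [a u] on
    [Vh], and with it [u]. *)
Lemma mixed_problem_stability l u r D : mixed l u r -> 0 <= D ->
  (forall v, Vh v -> l v <= D * `|v|) -> `|r| <= D /\ beta * `|u| <= 2 * D.
Proof.
move=> [Uu Vr rE ra] D0 lD.
have rD : `|r| <= D.
  have [->|r0] := eqVneq r 0; first by rewrite normr0.
  rewrite -(ler_pM2r (_ : 0 < `|r|)) ?normr_gt0// -expr2 (sqr_norm_dot dotN).
  by apply: le_trans (lD r Vr); rewrite -rE// ra// addr0.
split=> //; apply: (inf_sup_bound infsup Uu); first by rewrite mulr_ge0.
move=> v Vv; have -> : a u v = l v + dot (- r) v.
  by rewrite linearNl/= -rE//; ring.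
rewrite mulr2n mulrDl mul1r mulrDl; apply: lerD; first exact: lD.
apply: (le_trans (dot_le_norm dotN _ _)).
by rewrite normrN ler_wpM2r.
Qed.

Lemma well_posed_residual_minimisers : well_posed minimisers.
Proof.
split=> [l _|l u _ minu eps eps0].
  have [u [r mix]] := mixed_problem_exists l.
  have [minu _] := (residual_minimisersP l u r).2 mix.
  exists u; split=> // u' minu'.
  have mix' : mixed l u' (rr l u') by apply/residual_minimisersP.
  have ll v : Vh v -> (l \- l) v <= 0 * `|v| by rewrite /= subrr mul0r.
  have [_] := mixed_problem_stability (mixed_problemB mix mix') (lexx 0) ll.
  by rewrite mulr0 pmulr_rle0// normr_le0 => /eqP/subr0_eq.
have mix : mixed l u (rr l u) by apply/residual_minimisersP.
exists (beta * eps / 4) => [|l' u' _ minu' dl]; first by rewrite divr_gt0 ?mulr_gt0.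
have mix' : mixed l' u' (rr l' u') by apply/residual_minimisersP.
have D0 : 0 < beta * eps / 4 by rewrite divr_gt0 ?mulr_gt0.
have [_] := mixed_problem_stability (mixed_problemB mix' mix) (ltW D0)
  (fun v _ => dual_norm_bound (l := l' \- l) dl v).
move=> bd; rewrite -(ltr_pM2l beta_gt0); apply: (le_lt_trans bd).
have := mulr_gt0 beta_gt0 eps0; lra.
Qed.

(** Galerkin orthogonality: [a u] and [l] agree, so [(uh - w, rh)] solves the
    mixed problem with datum [a (u - w)], bounded by [gamma * `|u - w|]. *)
Lemma residual_minimiser_error l u uh rh w (gamma : R) :
  (forall v, a u v = l v) -> 0 <= gamma ->
  (forall w v, a w v <= gamma * `|w| * `|v|) ->
  mixed l uh rh -> Uh w ->
  `|rh| <= gamma * `|u - w| /\ beta * `|uh - w| <= 2 * (gamma * `|u - w|).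
Proof.
move=> uE gamma0 agamma [Uuh Vrh rhE rha] Uw.
have D0 : 0 <= gamma * `|u - w| by exact: mulr_ge0.
apply: (mixed_problem_stability (l := a (u - w))) => // [|v _]; last exact: agamma.
split=> // [|v Vv]; first exact: finite_dimB.
by rewrite /= !linearBl/= uE -rhE//; ring.
Qed.

End ResidualMinimisation.

Unset Implicit Arguments.

Theorem theorem3p1 (R : realType) (U : completeNormedModType R)
    (dot : {dot U for idfun}) (a : {biscalar U}) (ell : {scalar U})
    (gamma beta0 beta : R) (u : U) (Uh Vh : set U) :
  induces_norm dot ->
  0 < gamma ->
  (forall w v : U, a w v <= gamma * `|w| * `|v|) ->
  0 < beta0 ->
  (beta0%:E <= inf_sup a setT setT)%E ->
  bounded_functional ell ->
  well_posed (continuous_problem a) ->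
  continuous_problem a ell u ->
  finite_dim_subspace Uh ->
  finite_dim_subspace Vh ->
  0 < beta ->
  (beta%:E <= inf_sup a Uh Vh)%E ->
  [/\ forall l : {scalar U}, bounded_functional l ->
        forall w : U, Uh w -> exists! r : U, is_residual_riesz dot a Vh l w r,
      well_posed (residual_minimisers dot a Uh Vh),
      forall uh rh : U,
        (residual_minimisers dot a Uh Vh ell uh
         /\ rh = residual_riesz dot a Vh ell uh)
        <-> mixed_problem dot a Uh Vh ell uh rh
    & forall uh rh : U,
        residual_minimisers dot a Uh Vh ell uh ->
        rh = residual_riesz dot a Vh ell uh ->
        `|rh| <= inf [set 4 * gamma * `|u - w| | w in Uh] /\
        `|u - uh| <= (1 + 4 * gamma / beta) * inf [set `|u - w| | w in Uh]].
Proof.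
move=> dotN gamma0 agamma _ _ _ _ uE finU finV beta0' infsup.
split.
- by move=> l _ w _; exact: residual_riesz_exists_unique.
- exact: (well_posed_residual_minimisers dotN finU finV beta0' infsup).
- exact: residual_minimisersP.
move=> uh rh minuh rhE.
have mix : mixed_problem dot a Uh Vh ell uh rh.
  by apply/(residual_minimisersP _ dotN finU finV).
have err w := residual_minimiser_error dotN finU infsup uE (ltW gamma0) agamma
  mix (w := w).
have Uh0 := finite_dim0 finU.
have gw w : 0 <= gamma * `|u - w| by rewrite mulr_ge0// ltW.
split.
  apply: lb_le_inf; first by exists (4 * gamma * `|u - 0|), 0.
  move=> _ [w Uw <-]; have [+ _] := err w Uw.
  by have := gw w; lra.
have c0 : 0 < 1 + 4 * gamma / beta by rewrite ltr_wpDr// divr_ge0 ?mulr_ge0 ?ltW.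
rewrite mulrC -ler_pdivrMr//; apply: lb_le_inf; first by exists `|u - 0|, 0.
move=> _ [w Uw <-]; rewrite ler_pdivrMr//.
have [_ +] := err w Uw; rewrite -ler_pdivlMl// => uhw.
have -> : u - uh = (u - w) - (uh - w) by rewrite opprB addrA subrK.
apply: (le_trans (ler_normB _ _)).
rewrite mulrDr mulr1 lerD2l; apply: (le_trans uhw).
rewrite [leRHS](_ : _ = beta^-1 * (4 * (gamma * `|u - w|))); last by ring.
rewrite ler_pM2l ?invr_gt0//.
by have := gw w; lra.
Qed.
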